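(* Let $U_L=(h_L,u_L,a_L)\in A_1$ and $U_R=(h_R,u_R,a_R)$ with $a_L<a_R$. Set $U_1=(h_1,u_1,a_R):=SW(U_L,a_R)$ and let $\{U_2\}=\mathcal W_1(U_1)\cap\mathcal W_2^B(U_R)$, $U_2=(h_2,u_2,a_R)$. Let $\tilde h_1$ be the $h$-component of the state $\tilde U_1$ associated with $U_1\in A_1$. If $h_2\le \tilde h_1$, then the Riemann problem for the shallow water equations with data $(U_L,U_R)$ admits an admissible solution with the structure $$W_3(U_L,U_1)\oplus W_1(U_1,U_2)\oplus W_2(U_2,U_R).$$
   Context: System: $\partial_t h+\partial_x(hu)=0$, $\partial_t(hu)+\partial_x\big(h(u^2+g h/2)\big)=-gh\,\partial_x a$, $\partial_t a=0$, with $g>0$ constant, state $U=(h,u,a)$, $h>0$. The Riemann problem with data $(U_L,U_R)$ has initial condition $U_L$ for $x<0$ and $U_R$ for $x>0$. Characteristic speeds: $\lambda_1(U)=u-\sqrt{gh}$, $\lambda_2(U)=u+\sqrt{gh}$, $\lambda_3(U)=0$. Regions: $A_1=\{\lambda_2>\lambda_1>0\}$, $A_2=\{\lambda_2>0>\lambda_1\}$, $A_3=\{0>\lambda_2>\lambda_1\}$; $\mathcal C_\pm=\{u=\pm\sqrt{gh}\}$, $\mathcal C=\mathcal C_+\cup\mathcal C_-$. Wave curves (all with $a=a_0$ fixed, $h>0$), for $U_0=(h_0,u_0,a_0)$. $\mathcal W_1(U_0)$ is the set of right-hand states $(h,u,a_0)$ with $u=u_0-\sqrt{g/2}\,(h-h_0)\sqrt{1/h+1/h_0}$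 if $h>h_0$ (1-shock) and $u=u_0-2\sqrt g(\sqrt h-\sqrt{h_0})$ if $h\le h_0$ (1-rarefaction). $\mathcal W_2^B(U_0)$ is the set of left-hand states $(h,u,a_0)$ with $u=u_0+\sqrt{g/2}\,(h-h_0)\sqrt{1/h+1/h_0}$ if $h>h_0$ (2-shock) and $u=u_0+2\sqrt g(\sqrt h-\sqrt{h_0})$ if $h\le h_0$ (2-rarefaction). A shock from $U_0$ to $U$ has speed $\bar\lambda=(hu-h_0u_0)/(h-h_0)$; an $i$-rarefaction from $U$ to $V$ occupies the speeds $[\lambda_i(U),\lambda_i(V)]$. For $U\in A_1$, $\tilde U$ denotes the unique state on the 1-shock part ($\tilde h>h$) of $\mathcal W_1(U)$ for which the shock speed between $U$ and $\tilde U$ is $0$; $\tilde h$ is its $h$-component. Stationary waves: a stationary wave (speed $0$) joins $U_0$ to $U$ when $hu=h_0u_0$ and $\frac{u^2}{2}+g(h+a)=\frac{u_0^2}{2}+g(h_0+a_0)$. For $u_0\ne0$ let $\varphi(h)=a_0-a+\frac{u_0^2}{2g}\big(\frac{h_0^2}{h^2}-1\big)+h-h_0$, $h_{\min}(U_0)=(u_0^2h_0^2/g)^{1/3}$ and $a_{\min}(U_0)=a_0+\frac{u_0^2}{2g}\big(\frac{h_0^2}{h_{\min}^2}-1\big)+h_{\min}-h_0$; if $a\ge a_{\min}(U_0)$, let $h_*\le h_{\min}\le h^*$ be the roots of $\varphi$ in $(0,\infty)$. $SW(U_0,a)$ is the state $(h,h_0u_0/h,a)$ with $h=h_*$ if $U_0\in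 A_1\cup A_3$ and $h=h^*$ if $U_0\in A_2$, $u_0\neq 0$; if $U_0\in\mathcal C$ both values $h_*,h^*$ are allowed ($SW$ is two-valued); if $u_0=0$, $SW(U_0,a)=(h_0+a_0-a,0,a)$ (when $h_0+a_0-a>0$). $W_i(U,V)$ denotes the (possibly trivial) $i$-wave with left state $U$ and right state $V$: a Lax shock or rarefaction for $i=1,2$, a stationary wave for $i=3$. $W_i(U,V)\oplus W_j(V,Z)$ means that $W_i(U,V)$ is followed by $W_j(V,Z)$. Such a concatenation from $U_L$ to $U_R$ is an admissible solution of the Riemann problem when each wave is admissible, the waves can be placed in this order from left to right in the $(x,t)$-plane (all speeds in each wave are $\le$ all speeds in the next wave), and the Monotonicity Criterion holds: along each stationary wave, $a$ varies monotonically in $h$ on the curve $h\mapsto\big(u=\frac{h_0u_0}{h},\,a=a_0+\frac{u^2-u_0^2}{2g}+h-h_0\big)$, and the total variation of $a$ in the solution is $|a_L-a_R|$.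
   Formalization: The printed φ, a_min and stationary curve contradict the Bernoulli relation defining stationary waves; the sign is corrected: φ has a−a_0, the curve is a=a_0−[(u²−u_0²)/(2g)+h−h_0], and ''a≥a_min'' becomes a≤a_max. *)

(* Defs.v *)
From Stdlib Require Import Reals List.
From Coquelicot Require Import Coquelicot.
Open Scope R_scope.

Record state : Type := State { hgt : R; vel : R; bot : R }.

Inductive family : Type := fam1 | fam2 | fam3.

Definition lambda (g : R) (i : family) (U : state) : R :=
  match i with
  | fam1 => vel U - sqrt (g * hgt U)
  | fam2 => vel U + sqrt (g * hgt U)
  | fam3 => 0
  end.

Definition region_A1 (g : R) (U : state) : Prop :=
  lambda g fam2 U > lambda g fam1 U /\ lambda g fam1 U > 0.
Definition region_A2 (g : R) (U : state) : Prop :=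
  lambda g fam2 U > 0 /\ 0 > lambda g fam1 U.
Definition region_A3 (g : R) (U : state) : Prop :=
  0 > lambda g fam2 U /\ lambda g fam2 U > lambda g fam1 U.
Definition critical (g : R) (U : state) : Prop :=
  vel U = sqrt (g * hgt U) \/ vel U = - sqrt (g * hgt U).

Definition W1 (g : R) (U0 U : state) : Prop :=
  0 < hgt U /\ bot U = bot U0 /\
  (hgt U > hgt U0 ->
     vel U = vel U0 - sqrt (g / 2) * (hgt U - hgt U0)
                      * sqrt (1 / hgt U + 1 / hgt U0)) /\
  (hgt U <= hgt U0 ->
     vel U = vel U0 - 2 * sqrt g * (sqrt (hgt U) - sqrt (hgt U0))).

Definition W2B (g : R) (U0 U : state) : Prop :=
  0 < hgt U /\ bot U = bot U0 /\
  (hgt U > hgt U0 ->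
     vel U = vel U0 + sqrt (g / 2) * (hgt U - hgt U0)
                      * sqrt (1 / hgt U + 1 / hgt U0)) /\
  (hgt U <= hgt U0 ->
     vel U = vel U0 + 2 * sqrt g * (sqrt (hgt U) - sqrt (hgt U0))).

Definition shock_speed (U0 U : state) : R :=
  (hgt U * vel U - hgt U0 * vel U0) / (hgt U - hgt U0).

(* [tilde g U V] : V is the state on the 1-shock part of the 1-wave curve from
   U in A1 that is reached by a shock of speed zero. *)
Definition tilde (g : R) (U V : state) : Prop :=
  region_A1 g U /\ W1 g U V /\ hgt V > hgt U /\ shock_speed U V = 0.

Definition stationary (g : R) (U0 U : state) : Prop :=
  0 < hgt U0 /\ 0 < hgt U /\
  hgt U * vel U = hgt U0 * vel U0 /\
  vel U ^ 2 / 2 + g * (hgt U + bot U) = vel U0 ^ 2 / 2 + g * (hgt U0 + bot U0).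

(* Bottom level and height along the stationary curve through U0: eliminating u
   from the two relations of [stationary] by u = h0 u0 / h gives
   a = a0 - ((u^2 - u0^2) / (2 g) + h - h0).  For u0 <> 0 this is increasing
   in h up to [hmin U0] and decreasing afterwards, so that its maximum [amax]
   bounds the bottom levels that a stationary wave from U0 can reach. *)
Definition curve_bot (g : R) (U0 : state) (h : R) : R :=
  bot U0 - (((hgt U0 * vel U0 / h) ^ 2 - vel U0 ^ 2) / (2 * g) + h - hgt U0).

Definition phi (g : R) (U0 : state) (a h : R) : R :=
  a - bot U0 + vel U0 ^ 2 / (2 * g) * (hgt U0 ^ 2 / h ^ 2 - 1) + h - hgt U0.

Definition hmin (g : R) (U0 : state) : R :=
  Rpower (vel U0 ^ 2 * hgt U0 ^ 2 / g) (1 / 3).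

Definition amax (g : R) (U0 : state) : R :=
  bot U0 - (vel U0 ^ 2 / (2 * g) * (hgt U0 ^ 2 / hmin g U0 ^ 2 - 1)
            + hmin g U0 - hgt U0).

Definition root_low (g : R) (U0 : state) (a h : R) : Prop :=
  0 < h <= hmin g U0 /\ phi g U0 a h = 0.
Definition root_high (g : R) (U0 : state) (a h : R) : Prop :=
  hmin g U0 <= h /\ phi g U0 a h = 0.

(* [SW g U0 a U] : U is a value of the partial map SW(U0, a), which is
   two-valued when U0 is critical. *)
Definition SW (g : R) (U0 : state) (a : R) (U : state) : Prop :=
  (vel U0 <> 0 /\ a <= amax g U0 /\
   U = State (hgt U) (hgt U0 * vel U0 / hgt U) a /\
   (((region_A1 g U0 \/ region_A3 g U0) /\ root_low g U0 a (hgt U)) \/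
    (region_A2 g U0 /\ root_high g U0 a (hgt U)) \/
    (critical g U0 /\ (root_low g U0 a (hgt U) \/ root_high g U0 a (hgt U)))))
  \/
  (vel U0 = 0 /\ 0 < hgt U0 + bot U0 - a /\
   U = State (hgt U0 + bot U0 - a) 0 a).

Definition mass_flux (U : state) : R := hgt U * vel U.
Definition momentum_flux (g : R) (U : state) : R :=
  hgt U * (vel U ^ 2 + g * hgt U / 2).

(* Rankine-Hugoniot relations, the first one being solved for the speed, and
   the Lax shock inequalities. *)
Definition lax_shock (g : R) (i : family) (U V : state) : Prop :=
  0 < hgt U /\ 0 < hgt V /\ bot V = bot U /\ hgt V <> hgt U /\
  shock_speed U V * (mass_flux V - mass_flux U)
    = momentum_flux g V - momentum_flux g U /\
  lambda g i V < shock_speed U V < lambda g i U.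

(* Centred rarefaction: the profile P, as a function of xi = x / t, satisfies
   -xi (h, hu)' + (hu, h (u^2 + g h / 2))' = 0, with xi = lambda_i (P xi).
   Continuity at the endpoints loses no generality, since P may be extended by
   constants outside the fan. *)
Definition rarefaction (g : R) (i : family) (U V : state) : Prop :=
  lambda g i U < lambda g i V /\
  exists P : R -> state,
    P (lambda g i U) = U /\ P (lambda g i V) = V /\
    (forall xi, lambda g i U <= xi <= lambda g i V ->
       0 < hgt (P xi) /\ bot (P xi) = bot U /\ lambda g i (P xi) = xi /\
       continuous (fun z => hgt (P z)) xi /\
       continuous (fun z => vel (P z)) xi) /\
    (forall xi, lambda g i U < xi < lambda g i V ->
       exists dh dq : R,
         is_derive (fun z => hgt (P z)) xi dh /\
         is_derive (fun z => mass_flux (P z)) xi dq /\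
         dq = xi * dh /\
         is_derive (fun z => momentum_flux g (P z)) xi (xi * dq)).

(* [Wave i U V] stands for the i-wave W_i(U, V) with left state U and right
   state V; a concatenation of waves is a list, read from left to right. *)
Record wave : Type := Wave { wfam : family; wleft : state; wright : state }.

Definition is_wave (g : R) (w : wave) : Prop :=
  wleft w = wright w \/
  match wfam w with
  | fam3 => stationary g (wleft w) (wright w)
  | i => lax_shock g i (wleft w) (wright w) \/
         rarefaction g i (wleft w) (wright w)
  end.

(* The speeds occupied by a wave; a trivial wave occupies none. *)
Definition wave_speed (g : R) (w : wave) (s : R) : Prop :=
  wleft w <> wright w /\
  match wfam w with
  | fam3 => s = 0
  | i => (lax_shock g i (wleft w) (wright w) /\
            s = shock_speed (wleft w) (wright w)) \/
         (rarefaction g i (wleft w) (wright w) /\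
            lambda g i (wleft w) <= s <= lambda g i (wright w))
  end.

Definition precedes (g : R) (w w' : wave) : Prop :=
  forall s s', wave_speed g w s -> wave_speed g w' s' -> s <= s'.

Fixpoint joins (U : state) (ws : list wave) (V : state) : Prop :=
  match ws with
  | nil => U = V
  | w :: ws' => wleft w = U /\ joins (wright w) ws' V
  end.

Definition monotone_between (f : R -> R) (x y : R) : Prop :=
  let I z := Rmin x y <= z <= Rmax x y in
  (forall z z', I z -> I z' -> z <= z' -> f z <= f z') \/
  (forall z z', I z -> I z' -> z <= z' -> f z >= f z').

Definition bot_variation (ws : list wave) : R :=
  fold_right (fun w v => Rabs (bot (wright w) - bot (wleft w)) + v) 0 ws.

Definition monotonicity_criterion (g : R) (UL UR : state) (ws : list wave)
  : Prop :=
  (forall w, In w ws -> wfam w = fam3 ->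
     monotone_between (curve_bot g (wleft w))
                      (hgt (wleft w)) (hgt (wright w))) /\
  bot_variation ws = Rabs (bot UL - bot UR).

Definition admissible_solution (g : R) (UL UR : state) (ws : list wave) : Prop :=
  joins UL ws UR /\
  List.Forall (is_wave g) ws /\
  (* all pairs, not only consecutive ones: a wave in between may be trivial *)
  ForallOrdPairs (precedes g) ws /\
  monotonicity_criterion g UL UR ws.

(* Main.v *)
(** Along the stationary curve through a supercritical state the bottom level
    increases with the height up to [hmin], so the stationary wave raises the
    height and stays supercritical. The states connected by [W1] and [W2B] lie
    on the Hugoniot locus or on a level set of a Riemann invariant, which makes
    the last two waves Lax shocks or rarefactions. The speeds of any 1-wave are
    below the velocity of its right state and those of any 2-wave above the
    velocity of its left state, which orders these two waves. The speed of the
    1-shock is [u1 - slope h1 h * h] and decreases with [h]; as it vanishes at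
    the height of the tilde state, the bound on [h2] makes it nonnegative. *)

Require Import Defs.
From Stdlib Require Import Reals List Lra.
From Coquelicot Require Import Coquelicot.
Open Scope R_scope.

(** * Elementary facts on square roots, states and characteristic speeds *)

Lemma sqrt_lt_of_sqr (x y : R) : 0 <= x -> 0 <= y -> x < y ^ 2 -> sqrt x < y.
Proof.
  intros Hx Hy Hxy. rewrite <- (sqrt_pow2 y Hy). apply sqrt_lt_1; nra.
Qed.

Lemma lt_sqrt_of_sqr (x y : R) : 0 <= y -> y ^ 2 < x -> y < sqrt x.
Proof.
  intros Hy Hxy. rewrite <- (sqrt_pow2 y Hy). apply sqrt_lt_1; nra.
Qed.

Lemma state_eq (U V : state) :
  hgt U = hgt V -> vel U = vel V -> bot U = bot V -> U = V.
Proof. destruct U, V; simpl; intros; subst; reflexivity. Qed.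

(** The sign of [sqrt (g * h)] in [lambda], so that one argument serves both nonlinear families. The
    value at [fam3] is a placeholder. *)
Definition sgn (i : Defs.family) : R :=
  match i with fam1 => -1 | fam2 => 1 | fam3 => 0 end.

Lemma sgn_sqr (i : Defs.family) : i <> fam3 -> sgn i * sgn i = 1.
Proof. destruct i; simpl; intros; try lra; congruence. Qed.

Lemma lambda_sgn (g : R) (i : Defs.family) (U : state) :
  i <> fam3 -> lambda g i U = vel U + sgn i * sqrt (g * hgt U).
Proof. destruct i; simpl; intros; try lra; congruence. Qed.

(** * The stationary curve through a supercritical state *)

Lemma cube_hmin (g : R) (U : state) :
  0 < g -> 0 < hgt U -> vel U <> 0 ->
  0 < hmin g U /\ g * hmin g U ^ 3 = (hgt U * vel U) ^ 2.
Proof.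
  intros Hg Hh Hu.
  assert (Hq : 0 < vel U ^ 2 * hgt U ^ 2 / g).
  { apply Rdiv_lt_0_compat; [|exact Hg].
    apply Rmult_lt_0_compat; [|nra].
    assert (0 < vel U * vel U) by (apply Rsqr_pos_lt; exact Hu). nra. }
  split.
  - apply exp_pos.
  - rewrite <- Rpower_pow by apply exp_pos.
    unfold hmin. rewrite Rpower_mult.
    replace (1 / 3 * INR 3) with 1 by (simpl; field).
    rewrite Rpower_1 by exact Hq. field. lra.
Qed.

Lemma curve_bot_increasing (g : R) (U : state) (x y : R) :
  0 < g -> 0 < hgt U -> vel U <> 0 ->
  0 < x -> x <= y -> y <= hmin g U ->
  curve_bot g U x <= curve_bot g U y.
Proof.
  intros Hg Hh Hu Hx Hxy Hy.
  destruct (cube_hmin g U Hg Hh Hu) as [Hm Hm3].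
  set (m := hmin g U) in *.
  (* Once [(h0 u0)^2] is written as [g m^3], the difference has the factor [y - x]; both brackets
     are nonnegative because [x] and [y] are at most [m]. *)
  assert (E : curve_bot g U y - curve_bot g U x
    = (y - x) * ((m ^ 3 - x * y ^ 2) * x + (m ^ 3 - x ^ 2 * y) * y)
        / (2 * x ^ 2 * y ^ 2)).
  { unfold curve_bot.
    replace ((hgt U * vel U / y) ^ 2) with (g * m ^ 3 / y ^ 2)
      by (rewrite Hm3; field; lra).
    replace ((hgt U * vel U / x) ^ 2) with (g * m ^ 3 / x ^ 2)
      by (rewrite Hm3; field; lra).
    field. lra. }
  assert (Hyy : y ^ 2 <= m ^ 2) by (apply pow_incr; lra).
  assert (Hxx : x ^ 2 <= m ^ 2) by (apply pow_incr; lra).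
  assert (H1 : x * y ^ 2 <= m * m ^ 2) by (apply Rmult_le_compat; nra).
  assert (H2 : x ^ 2 * y <= m ^ 2 * m) by (apply Rmult_le_compat; nra).
  assert (0 <= curve_bot g U y - curve_bot g U x); [|lra].
  rewrite E. apply Rdiv_le_0_compat.
  - apply Rmult_le_pos; [lra|].
    apply Rplus_le_le_0_compat; apply Rmult_le_pos; simpl in *; lra.
  - assert (0 < x ^ 2) by (apply pow_lt; lra).
    assert (0 < y ^ 2) by (apply pow_lt; lra). nra.
Qed.

Lemma A1_vel_pos (g : R) (U : state) : region_A1 g U -> 0 < vel U.
Proof.
  intros [_ H]. simpl in H. pose proof (sqrt_pos (g * hgt U)). lra.
Qed.

(** Multiplying [g h < u^2] by [h^2] compares [g h^3] with [(h u)^2 = g * hmin^3]. *)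
Lemma A1_below_hmin (g : R) (U : state) :
  0 < g -> 0 < hgt U -> region_A1 g U -> hgt U < hmin g U.
Proof.
  intros Hg Hh HA.
  pose proof (A1_vel_pos g U HA) as Hu.
  destruct (cube_hmin g U Hg Hh) as [Hm Hm3]; [lra|].
  destruct HA as [_ HA]; simpl in HA.
  assert (Hgh : 0 <= g * hgt U) by nra.
  pose proof (sqrt_pos (g * hgt U)) as Hs.
  pose proof (sqrt_sqrt _ Hgh) as Hss.
  assert (Hc : g * hgt U < vel U ^ 2) by nra.
  destruct (Rlt_le_dec (hgt U) (hmin g U)) as [|Hle]; [assumption|exfalso].
  assert (H3 : hmin g U ^ 3 <= hgt U ^ 3) by (apply pow_incr; lra).
  assert (0 < hgt U ^ 2) by (apply pow_lt; lra).
  assert (hgt U ^ 2 * (g * hgt U) < hgt U ^ 2 * vel U ^ 2)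
    by (apply Rmult_lt_compat_l; assumption).
  nra.
Qed.

(** Positivity of [lambda g fam1 U0] rules out the branches for zero velocity, for [region_A2] and
    for critical states. *)
Lemma SW_A1 (g : R) (U0 U : state) (a : R) :
  0 < g -> 0 < hgt U0 -> region_A1 g U0 -> SW g U0 a U ->
  bot U = a /\ vel U = hgt U0 * vel U0 / hgt U /\ root_low g U0 a (hgt U).
Proof.
  intros Hg Hh HA HS.
  pose proof (A1_vel_pos g U0 HA) as Hu.
  pose proof (sqrt_pos (g * hgt U0)) as Hs.
  assert (H1 : vel U0 - sqrt (g * hgt U0) > 0) by (destruct HA; assumption).
  destruct HS as [[_ [_ [E H]]] | [E _]]; [|lra].
  split; [rewrite E; reflexivity|].
  split; [rewrite E at 1; reflexivity|].
  destruct H as [[_ H] | [[[_ H] _] | [[H | H] _]]]; simpl in *;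
    solve [assumption | lra].
Qed.

Lemma phi_curve_bot (g : R) (U0 : state) (a h : R) :
  0 < g -> 0 < h -> phi g U0 a h = a - curve_bot g U0 h.
Proof. intros. unfold phi, curve_bot. field. lra. Qed.

Lemma curve_bot_base (g : R) (U : state) :
  0 < g -> 0 < hgt U -> curve_bot g U (hgt U) = bot U.
Proof. intros. unfold curve_bot. field. lra. Qed.

Lemma stationary_of_phi (g : R) (U0 U : state) :
  0 < g -> 0 < hgt U0 -> 0 < hgt U ->
  vel U = hgt U0 * vel U0 / hgt U -> phi g U0 (bot U) (hgt U) = 0 ->
  stationary g U0 U.
Proof.
  intros Hg H0 H Hv Hp. unfold phi in Hp.
  repeat split; try assumption.
  - rewrite Hv. field. lra.
  - replace (bot U) with (bot U0 - (vel U0 ^ 2 / (2 * g)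
      * (hgt U0 ^ 2 / hgt U ^ 2 - 1) + hgt U - hgt U0)) by lra.
    rewrite Hv. field. lra.
Qed.

(** * Shocks and the Hugoniot locus *)

(** Absolute slope of the chord from [h0] to [h] of the Hugoniot locus in the [(h, u)] plane. *)
Definition slope (g h0 h : R) : R := sqrt (g / 2) * sqrt (1 / h + 1 / h0).

Lemma slope_pos (g h0 h : R) : 0 < g -> 0 < h0 -> 0 < h -> 0 < slope g h0 h.
Proof.
  intros. unfold slope.
  apply Rmult_lt_0_compat; apply sqrt_lt_R0; [lra|].
  apply Rplus_lt_0_compat; apply Rdiv_lt_0_compat; lra.
Qed.

Lemma slope_sqr (g h0 h : R) :
  0 < g -> 0 < h0 -> 0 < h ->
  slope g h0 h ^ 2 = g * (h + h0) / (2 * h * h0).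
Proof.
  intros. unfold slope.
  rewrite Rpow_mult_distr, !pow2_sqrt; [field; lra| |lra].
  apply Rplus_le_le_0_compat; apply Rlt_le, Rdiv_lt_0_compat; lra.
Qed.

(** The square of [slope g h0 h * h] is [g h (h + h0) / (2 h0)], which increases with [h]. *)
Lemma slope_mul_increasing (g h0 h h' : R) :
  0 < g -> 0 < h0 -> 0 < h -> h <= h' -> slope g h0 h * h <= slope g h0 h' * h'.
Proof.
  intros Hg H0 H Hle.
  pose proof (slope_pos g h0 h Hg H0 H).
  pose proof (slope_pos g h0 h' Hg H0 ltac:(lra)).
  apply Rsqr_incr_0; [|nra|nra].
  unfold Rsqr.
  replace (slope g h0 h * h * (slope g h0 h * h))
    with (slope g h0 h ^ 2 * h ^ 2) by ring.
  replace (slope g h0 h' * h' * (slope g h0 h' * h'))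
    with (slope g h0 h' ^ 2 * h' ^ 2) by ring.
  rewrite !slope_sqr by lra.
  assert (E : g * (h' + h0) / (2 * h' * h0) * h' ^ 2
              - g * (h + h0) / (2 * h * h0) * h ^ 2
              = g * ((h' - h) * (h' + h + h0)) / (2 * h0)) by (field; lra).
  assert (0 <= g * ((h' - h) * (h' + h + h0)) / (2 * h0)); [|lra].
  apply Rdiv_le_0_compat; [|lra].
  apply Rmult_le_pos; [lra|]. apply Rmult_le_pos; lra.
Qed.

Lemma shock_speed_sym (U V : state) :
  hgt U <> hgt V -> shock_speed U V = shock_speed V U.
Proof. intros. unfold shock_speed. field. lra. Qed.

(* The same relation describes 1-shocks with [U0] on the left and 2-shocks with
   [U0] on the right: [U0] is always the shallow side. *)
Definition hugoniot (g : R) (i : Defs.family) (U0 U : state) : Prop :=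
  vel U = vel U0 + sgn i * (slope g (hgt U0) (hgt U) * (hgt U - hgt U0)).

(** Measuring the speed relative to either side reduces the Lax inequalities to bounds on
    [slope]. *)
Lemma hugoniot_speed (g : R) (i : Defs.family) (U0 U : state) :
  hgt U0 < hgt U -> hugoniot g i U0 U ->
  shock_speed U0 U = vel U0 + sgn i * (slope g (hgt U0) (hgt U) * hgt U) /\
  shock_speed U0 U = vel U + sgn i * (slope g (hgt U0) (hgt U) * hgt U0).
Proof.
  intros Hlt E. unfold hugoniot in E. unfold shock_speed.
  split; rewrite E; field; lra.
Qed.

Lemma rankine_hugoniot (g : R) (i : Defs.family) (U0 U : state) :
  i <> fam3 -> 0 < g -> 0 < hgt U0 -> hgt U0 < hgt U -> hugoniot g i U0 U ->
  shock_speed U0 U * (mass_flux U - mass_flux U0)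
    = momentum_flux g U - momentum_flux g U0.
Proof.
  intros Hi Hg H0 Hlt E.
  pose proof (sgn_sqr i Hi) as He.
  pose proof (slope_sqr g (hgt U0) (hgt U) Hg H0 ltac:(lra)) as Hk.
  unfold hugoniot in E. unfold shock_speed, mass_flux, momentum_flux.
  set (d := vel U - vel U0).
  (* Eliminating the shock speed turns the momentum relation into this identity for the velocity
     jump; the sign of the family disappears on squaring. *)
  assert (Hd : hgt U * hgt U0 * d ^ 2
               = g / 2 * (hgt U - hgt U0) ^ 2 * (hgt U + hgt U0)).
  { unfold d. rewrite E.
    replace ((vel U0 + sgn i * (slope g (hgt U0) (hgt U) * (hgt U - hgt U0))
              - vel U0) ^ 2)
      with (sgn i * sgn i
            * (slope g (hgt U0) (hgt U) ^ 2 * (hgt U - hgt U0) ^ 2)) by ring.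
    rewrite He, Hk. field. lra. }
  replace (vel U) with (vel U0 + d) by (unfold d; ring).
  apply (Rmult_eq_reg_r (hgt U - hgt U0)); [|lra].
  unfold Rdiv at 1.
  rewrite !Rmult_assoc, (Rmult_comm (/ _)), !Rmult_assoc, Rinv_r, Rmult_1_r
    by lra.
  ring_simplify in Hd. ring_simplify. nra.
Qed.

(** Each bound is a Lax inequality, on the shallow and on the deep side. In both, the difference of
    the squares has the factor [y - x]. *)
Lemma slope_bounds (g x y : R) :
  0 < g -> 0 < x -> x < y ->
  sqrt (g * x) < slope g x y * y /\ slope g x y * x < sqrt (g * y).
Proof.
  intros Hg H0 Hlt.
  pose proof (slope_pos g x y Hg H0 ltac:(lra)) as Hp.
  pose proof (slope_sqr g x y Hg H0 ltac:(lra)) as Hk.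
  split.
  - apply sqrt_lt_of_sqr; [nra|nra|].
    rewrite Rpow_mult_distr, Hk.
    assert (E : g * (y + x) / (2 * y * x) * y ^ 2 - g * x
                = g * ((y - x) * (y + 2 * x)) / (2 * x)) by (field; lra).
    assert (0 < g * ((y - x) * (y + 2 * x)) / (2 * x)); [|lra].
    apply Rdiv_lt_0_compat; [|lra].
    apply Rmult_lt_0_compat; [lra|]. apply Rmult_lt_0_compat; lra.
  - apply lt_sqrt_of_sqr; [nra|].
    rewrite Rpow_mult_distr, Hk.
    assert (E : g * y - g * (y + x) / (2 * y * x) * x ^ 2
                = g * ((y - x) * (2 * y + x)) / (2 * y)) by (field; lra).
    assert (0 < g * ((y - x) * (2 * y + x)) / (2 * y)); [|lra].
    apply Rdiv_lt_0_compat; [|lra].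
    apply Rmult_lt_0_compat; [lra|]. apply Rmult_lt_0_compat; lra.
Qed.

Lemma W1_hugoniot (g : R) (U0 U : state) :
  W1 g U0 U -> hgt U0 < hgt U -> hugoniot g fam1 U0 U.
Proof.
  intros (_ & _ & H & _) Hlt. unfold hugoniot, slope. rewrite H by lra.
  simpl. ring.
Qed.

Lemma W2B_hugoniot (g : R) (U0 U : state) :
  W2B g U0 U -> hgt U0 < hgt U -> hugoniot g fam2 U0 U.
Proof.
  intros (_ & _ & H & _) Hlt. unfold hugoniot, slope. rewrite H by lra.
  simpl. ring.
Qed.

Lemma W1_lax_shock (g : R) (U V : state) :
  0 < g -> 0 < hgt U -> W1 g U V -> hgt U < hgt V -> lax_shock g fam1 U V.
Proof.
  intros Hg HU HW Hlt.
  pose proof (W1_hugoniot g U V HW Hlt) as HH.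
  destruct (hugoniot_speed g fam1 U V Hlt HH) as [E1 E2].
  destruct (slope_bounds g (hgt U) (hgt V) Hg HU Hlt) as [B1 B2].
  destruct HW as (HV & Hb & _). simpl in E1, E2.
  repeat split; try assumption; try lra.
  - apply (rankine_hugoniot g fam1); try assumption; discriminate.
  - rewrite E2. simpl. lra.
  - rewrite E1. simpl. lra.
Qed.

Lemma W2B_lax_shock (g : R) (U V : state) :
  0 < g -> 0 < hgt V -> W2B g V U -> hgt V < hgt U -> lax_shock g fam2 U V.
Proof.
  intros Hg HV HW Hlt.
  pose proof (W2B_hugoniot g V U HW Hlt) as HH.
  destruct (hugoniot_speed g fam2 V U Hlt HH) as [E1 E2].
  destruct (slope_bounds g (hgt V) (hgt U) Hg HV Hlt) as [B1 B2].
  pose proof (rankine_hugoniot g fam2 V U ltac:(discriminate) Hg HV Hlt HH).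
  destruct HW as (HU & Hb & _). simpl in E1, E2.
  unfold lax_shock.
  rewrite (shock_speed_sym U V) by lra.
  repeat split; try assumption; try (symmetry; assumption); try lra.
  - rewrite E1. simpl. lra.
  - rewrite E2. simpl. lra.
Qed.

(** * Rarefactions and Riemann invariants *)

Definition riemann_invariant (g : R) (i : Defs.family) (U : state) : R :=
  vel U - sgn i * (2 * sqrt (g * hgt U)).

(* In a fan the invariant [C] is constant; solving [u - 2 e c = C] and
   [u + e c = xi] with [c = sqrt (g h)] gives [c = e (xi - C) / 3] and hence the
   profile below, which does not depend on the sign [e]. *)
Lemma rarefaction_of_invariant (g : R) (i : Defs.family) (U V : state) :
  i <> fam3 -> 0 < g -> 0 < hgt U -> 0 < hgt V -> bot V = bot U ->
  riemann_invariant g i U = riemann_invariant g i V ->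
  lambda g i U < lambda g i V -> rarefaction g i U V.
Proof.
  intros Hi Hg HU HV Hb HC Hlt. split; [exact Hlt|].
  pose proof (sgn_sqr i Hi) as He.
  assert (HgU : 0 < g * hgt U) by nra.
  assert (HgV : 0 < g * hgt V) by nra.
  pose proof (sqrt_lt_R0 _ HgU) as HsU.
  pose proof (sqrt_lt_R0 _ HgV) as HsV.
  set (C := riemann_invariant g i U) in *.
  set (P := fun z => State ((z - C) ^ 2 / (9 * g)) ((2 * z + C) / 3) (bot U)).
  (* At its own characteristic speed, every state with invariant [C] is recovered by [P]; this
     serves both endpoints. *)
  assert (HP : forall W, 0 < hgt W -> bot W = bot U ->
    riemann_invariant g i W = C -> P (lambda g i W) = W).
  { intros W HW HbW HCW. pose proof (lambda_sgn g i W Hi) as L.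
    unfold riemann_invariant in HCW.
    apply state_eq; unfold P; cbn [hgt vel bot].
    - replace (lambda g i W - C) with (sgn i * (3 * sqrt (g * hgt W))) by lra.
      replace ((sgn i * (3 * sqrt (g * hgt W))) ^ 2)
        with (sgn i * sgn i * 9 * (sqrt (g * hgt W) ^ 2)) by ring.
      rewrite He, pow2_sqrt by nra. field. lra.
    - lra.
    - symmetry; exact HbW. }
  (* At both ends [e (xi - C)] equals [3 sqrt (g h) > 0], hence it is positive in between. This
     keeps the height positive and fixes the sign of the root below. *)
  assert (Hpos : forall xi, lambda g i U <= xi <= lambda g i V ->
    0 < sgn i * (xi - C)).
  { intros xi Hxi. rewrite !lambda_sgn in Hxi by exact Hi.
    unfold C, riemann_invariant in HC.
    assert (EU : vel U = C + sgn i * (2 * sqrt (g * hgt U)))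
      by (unfold C, riemann_invariant; ring).
    assert (EV : vel V = C + sgn i * (2 * sqrt (g * hgt V)))
      by (unfold C, riemann_invariant; lra).
    destruct i; simpl in *; try lra; congruence. }
  exists P. split; [apply HP; auto|].
  split; [apply HP; auto|].
  split.
  - intros xi Hxi. specialize (Hpos xi Hxi).
    split; [|split; [reflexivity|split; [|split]]].
    + unfold P; simpl. apply Rdiv_lt_0_compat; [|lra].
      assert (xi - C <> 0) by (intro E; rewrite E in Hpos; lra).
      assert (0 < (xi - C) * (xi - C)) by (apply Rsqr_pos_lt; assumption).
      lra.
    + rewrite lambda_sgn by exact Hi. unfold P; cbn [hgt vel].
      replace (g * ((xi - C) ^ 2 / (9 * g)))
        with ((sgn i * (xi - C) / 3) ^ 2).
      2:{ transitivity (sgn i * sgn i * (xi - C) ^ 2 / 9); [field|].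
          rewrite He. field. lra. }
      rewrite sqrt_pow2 by lra.
      replace (sgn i * (sgn i * (xi - C) / 3))
        with (sgn i * sgn i * (xi - C) / 3) by (field; lra).
      rewrite He. field.
    + apply (ex_derive_continuous (fun z => hgt (P z))).
      unfold P; cbn [hgt]. auto_derive; trivial.
    + apply (ex_derive_continuous (fun z => vel (P z))).
      unfold P; cbn [vel]. auto_derive; trivial.
  - intros xi _.
    exists (2 * (xi - C) / (9 * g)), (xi * (2 * (xi - C) / (9 * g))).
    unfold mass_flux, momentum_flux, P; cbn [hgt vel].
    split; [|split; [|split; [reflexivity|]]];
      auto_derive; trivial; field; lra.
Qed.

Lemma W1_below (g : R) (U V : state) :
  0 < g -> 0 < hgt U -> W1 g U V -> hgt V <= hgt U ->
  riemann_invariant g fam1 U = riemann_invariant g fam1 V.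
Proof.
  intros Hg HU (HV & _ & _ & H) Hle. unfold riemann_invariant; simpl.
  rewrite H, !sqrt_mult by lra. ring.
Qed.

Lemma W2B_below (g : R) (U V : state) :
  0 < g -> 0 < hgt V -> W2B g V U -> hgt U <= hgt V ->
  riemann_invariant g fam2 U = riemann_invariant g fam2 V.
Proof.
  intros Hg HV (HU & _ & _ & H) Hle. unfold riemann_invariant; simpl.
  rewrite H, !sqrt_mult by lra. ring.
Qed.

(** * From wave curves to waves *)

Lemma W1_is_wave (g : R) (U V : state) :
  0 < g -> 0 < hgt U -> W1 g U V -> is_wave g (Wave fam1 U V).
Proof.
  intros Hg HU HW. unfold is_wave; simpl.
  destruct (Rlt_le_dec (hgt U) (hgt V)) as [Hlt | Hle].
  - right; left. apply W1_lax_shock; assumption.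
  - pose proof (W1_below g U V Hg HU HW Hle) as HC.
    pose proof HW as (HV & Hb & _).
    destruct Hle as [Hlt | E].
    + right; right.
      apply rarefaction_of_invariant; try assumption; [discriminate|].
      (* With [u + 2 sqrt (g h)] constant, a smaller height gives a larger [u - sqrt (g h)]. *)
      assert (sqrt (g * hgt V) < sqrt (g * hgt U)) by (apply sqrt_lt_1; nra).
      unfold riemann_invariant in HC; simpl in *. lra.
    + left. unfold riemann_invariant in HC; simpl in HC. rewrite E in HC.
      apply state_eq; lra.
Qed.

Lemma W2B_is_wave (g : R) (U V : state) :
  0 < g -> 0 < hgt V -> W2B g V U -> is_wave g (Wave fam2 U V).
Proof.
  intros Hg HV HW. unfold is_wave; simpl.
  destruct (Rlt_le_dec (hgt V) (hgt U)) as [Hlt | Hle].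
  - right; left. apply W2B_lax_shock; assumption.
  - pose proof (W2B_below g U V Hg HV HW Hle) as HC.
    pose proof HW as (HU & Hb & _).
    destruct Hle as [Hlt | E].
    + right; right.
      apply rarefaction_of_invariant;
        try assumption; [discriminate|symmetry; assumption|].
      assert (sqrt (g * hgt U) < sqrt (g * hgt V)) by (apply sqrt_lt_1; nra).
      unfold riemann_invariant in HC; simpl in *. lra.
    + left. unfold riemann_invariant in HC; simpl in HC. rewrite E in HC.
      apply state_eq; lra.
Qed.

(** * Ordering of the wave speeds *)

(* [h (u - s)] takes the same value on both sides of a shock of speed [s]. *)
Lemma shock_mass_balance (U V : state) :
  hgt V <> hgt U ->
  hgt U * (vel U - shock_speed U V) = hgt V * (vel V - shock_speed U V).
Proof. intros. unfold shock_speed. field. lra. Qed.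

(** By the Lax inequalities a 1-shock is slower than the fluid on its left; the mass balance carries
    this to its right. *)
Lemma speed_fam1_le (g : R) (U V : state) (s : R) :
  wave_speed g (Wave fam1 U V) s -> s <= vel V.
Proof.
  intros [_ [[(HU & HV & _ & Hne & _ & HL) ->] | [_ Hs]]]; simpl in *.
  - pose proof (shock_mass_balance U V Hne).
    pose proof (sqrt_pos (g * hgt U)). nra.
  - pose proof (sqrt_pos (g * hgt V)). lra.
Qed.

Lemma speed_fam2_ge (g : R) (U V : state) (s : R) :
  wave_speed g (Wave fam2 U V) s -> vel U <= s.
Proof.
  intros [_ [[(HU & HV & _ & Hne & _ & HL) ->] | [_ Hs]]]; simpl in *.
  - pose proof (shock_mass_balance U V Hne).
    pose proof (sqrt_pos (g * hgt V)). nra.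
  - pose proof (sqrt_pos (g * hgt U)). lra.
Qed.

Lemma fam1_precedes_fam2 (g : R) (U V W : state) :
  precedes g (Wave fam1 U V) (Wave fam2 V W).
Proof.
  intros s s' Hs Hs'.
  apply speed_fam1_le in Hs. apply speed_fam2_ge in Hs'. lra.
Qed.

(** * Comparison of the 1-wave with the shock of zero speed *)

Lemma shock_speed_before_tilde (g : R) (U V Ut : state) :
  0 < g -> 0 < hgt U -> W1 g U V -> tilde g U Ut ->
  hgt U < hgt V -> hgt V <= hgt Ut -> 0 <= shock_speed U V.
Proof.
  intros Hg HU HW (_ & HWt & Hgt & Hz) Hlt Hle.
  destruct (hugoniot_speed g fam1 U V Hlt) as [E _].
  { apply W1_hugoniot; assumption. }
  destruct (hugoniot_speed g fam1 U Ut) as [Et _]; [lra| |].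
  { apply W1_hugoniot; [assumption|lra]. }
  pose proof (slope_mul_increasing g (hgt U) (hgt V) (hgt Ut) Hg HU).
  simpl in *. lra.
Qed.

Lemma W1_speed_nonneg (g : R) (U V Ut : state) (s : R) :
  0 < g -> 0 < hgt U -> W1 g U V -> tilde g U Ut -> hgt V <= hgt Ut ->
  wave_speed g (Wave fam1 U V) s -> 0 <= s.
Proof.
  intros Hg HU HW Ht Hle [_ [[HL ->] | [_ Hs]]]; simpl in *.
  - apply (shock_speed_before_tilde g U V Ut); try assumption.
    (* A Lax 1-shock on the curve raises the height: otherwise constancy of [u + 2 sqrt (g h)] would
       give the right state the larger or equal [lambda]. *)
    destruct (Rlt_le_dec (hgt U) (hgt V)) as [|Hle']; [assumption|exfalso].
    pose proof (W1_below g U V Hg HU HW Hle') as HC.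
    destruct HL as (_ & _ & _ & _ & _ & HL).
    assert (sqrt (g * hgt V) <= sqrt (g * hgt U)) by (apply sqrt_le_1_alt; nra).
    unfold riemann_invariant in HC; simpl in *. lra.
  - destruct Ht as ([_ HA] & _). simpl in HA. lra.
Qed.

(** This bound places the 2-wave after the stationary wave even if the 1-wave is trivial. The
    velocity behind a shock exceeds the shock speed, and along a rarefaction it does not drop below
    that of [U]. *)
Lemma W1_vel_nonneg (g : R) (U V Ut : state) :
  0 < g -> 0 < hgt U -> W1 g U V -> tilde g U Ut -> hgt V <= hgt Ut ->
  0 <= vel V.
Proof.
  intros Hg HU HW Ht Hle.
  destruct (Rlt_le_dec (hgt U) (hgt V)) as [Hlt | Hle'].
  - pose proof (shock_speed_before_tilde g U V Ut Hg HU HW Ht Hlt Hle) as Hs.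
    destruct (hugoniot_speed g fam1 U V Hlt) as [_ E].
    { apply W1_hugoniot; assumption. }
    pose proof (slope_pos g (hgt U) (hgt V) Hg HU ltac:(lra)).
    assert (0 < slope g (hgt U) (hgt V) * hgt U) by nra.
    simpl in E. lra.
  - pose proof (W1_below g U V Hg HU HW Hle') as HC.
    destruct Ht as (HA & _). pose proof (A1_vel_pos g U HA).
    assert (sqrt (g * hgt V) <= sqrt (g * hgt U)) by (apply sqrt_le_1_alt; nra).
    unfold riemann_invariant in HC; simpl in *. lra.
Qed.

Theorem theorem4p1 (g : R) (UL UR U1 U2 Ut1 : state)
  (g_pos : 0 < g) (hL_pos : 0 < hgt UL) (hR_pos : 0 < hgt UR)
  (UL_A1 : region_A1 g UL) (a_lt : bot UL < bot UR)
  (U1_def : SW g UL (bot UR) U1)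
  (U2_def : forall U : state, (W1 g U1 U /\ W2B g UR U) <-> U = U2)
  (Ut1_def : tilde g U1 Ut1)
  (h2_le : hgt U2 <= hgt Ut1) :
  admissible_solution g UL UR
    (Wave fam3 UL U1 :: Wave fam1 U1 U2 :: Wave fam2 U2 UR :: nil).
Proof.
  destruct (proj2 (U2_def U2) eq_refl) as [HW1 HW2].
  pose proof (A1_vel_pos g UL UL_A1) as HuL.
  pose proof (A1_below_hmin g UL g_pos hL_pos UL_A1) as HhL.
  destruct (SW_A1 g UL U1 (bot UR) g_pos hL_pos UL_A1 U1_def)
    as (Hb1 & Hv1 & [[Hh1 Hm1] Hphi]).
  assert (HuL0 : vel UL <> 0) by lra.
  (* If the height did not rise, monotonicity of [curve_bot] would put the bottom at [U1] no higher
     than at [UL]. *)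
  assert (Hlt1 : hgt UL < hgt U1).
  { destruct (Rlt_le_dec (hgt UL) (hgt U1)) as [|Hle]; [assumption|exfalso].
    pose proof (curve_bot_increasing g UL (hgt U1) (hgt UL) g_pos hL_pos HuL0
                  Hh1 Hle ltac:(lra)) as Hc.
    rewrite (curve_bot_base g UL g_pos hL_pos) in Hc.
    rewrite phi_curve_bot in Hphi by assumption. lra. }
  pose proof (W1_vel_nonneg g U1 U2 Ut1 g_pos Hh1 HW1 Ut1_def h2_le) as Hv2.
  split; [|split; [|split; [|split]]].
  - simpl. auto.
  - constructor; [|constructor; [|constructor; [|constructor]]].
    + right. simpl. apply stationary_of_phi; try assumption.
      rewrite Hb1. exact Hphi.
    + apply W1_is_wave; assumption.
    + apply W2B_is_wave; assumption.
  (* Three pairs remain: stationary wave and 1-wave, stationary wave and 2-wave, 1-wave and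
     2-wave. *)
  - constructor; [constructor; [|constructor; [|constructor]]|
      constructor; [constructor; [|constructor]|constructor;
        [constructor|constructor]]].
    + intros s s' [_ Hs] Hs'. simpl in Hs. subst s.
      exact (W1_speed_nonneg g U1 U2 Ut1 s' g_pos Hh1 HW1 Ut1_def h2_le Hs').
    + intros s s' [_ Hs] Hs'. simpl in Hs. subst s.
      apply speed_fam2_ge in Hs'. lra.
    + apply fam1_precedes_fam2.
  - intros w [<- | [<- | [<- | []]]] Hf; simpl in Hf; try discriminate.
    left. simpl. intros z z'.
    rewrite Rmin_left, Rmax_right by lra. intros Hz Hz' Hzz.
    apply curve_bot_increasing; try assumption; lra.
  (* Only the stationary wave changes the bottom level. *)
  - destruct HW1 as (_ & Hb2 & _). unfold bot_variation; simpl.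
    rewrite Hb2, Hb1, Rminus_diag, Rabs_R0, (Rabs_minus_sym (bot UR)). ring.
Qed.
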